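(* Fix $d\ge2$ and $\epsilon\in(0,1/(2\pi))$. For each $c\in\mathbb S^{d-1}$ let $\preccurlyeq_c$ denote the preference relation on $\mathcal X$ realized by $f_c(x)=\langle c,x\rangle$. Consider any algorithm with $t$ comparisons. Suppose that, for every realization of its private seed $\xi$ and every $c\in\mathbb S^{d-1}$, when the preference relation is $\preccurlyeq_c$ the algorithm outputs $\widehat n\in\mathbb S^{d-1}$ satisfying $\|\widehat n-c\|\le\epsilon$. Then $$t>(d-1)\log_2\left(\frac1{\pi\epsilon}\right)-1 .$$ Consequently, any comparison-based algorithm that guarantees worst-case normal-direction error at most $\epsilon$ over the class of plateau-free and regular preference relations must use $\Omega(d\log(1/\epsilon))$ comparisons, i.e. at least $\kappa\,d\log(1/\epsilon)$ comparisons for an absolute constant $\kappa>0$ (independent of $d$ and $\epsilon$).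
   Context: $\mathcal X$ is a $d$-dimensional real Euclidean space with inner product $\langle\cdot,\cdot\rangle$, norm $\|\cdot\|$, unit sphere $\mathbb S^{d-1}$ and closed balls $B(z,r)$. A preference relation $\preccurlyeq$ is a complete and transitive binary relation on $\mathcal X$; $x\sim y$ means $x\preccurlyeq y$ and $y\preccurlyeq x$; $x\prec y$ means $x\preccurlyeq y$ and not $y\preccurlyeq x$. A function $f$ realizes $\preccurlyeq$ if $x\preccurlyeq y\iff f(x)\le f(y)$. The comparison oracle on $(p,q)$ returns $-1$ if $q\prec p$, $0$ if $q\sim p$, $+1$ if $p\prec q$. An algorithm with $t$ comparisons ($t\ge 1$) has a private random seed $\xi$ sampled before the run. At round $i=1,\dots,t$, having observed the history $\mathcal T_{i-1}=((p_1,q_1,\sigma_1),\dots,(p_{i-1},q_{i-1},\sigma_{i-1}))$, where $\sigma_j$ is the oracle response to $(p_j,q_j)$, it chooses the next pair $(p_i,q_i)\in\mathcal X\times\mathcal X$ as a measurable function of $(\mathcal T_{i-1},\xi)$. After $t$ rounds its output is a measurable function of $(\mathcal T_t,\xi)$. Let $\mathcal S_x=\{y:y\preccurlyeq x\}$, $\mathcal L_x=\{y:y\sim x\}$, and, for a feasible set $\mathcal C\subseteq\mathcal X$, $\mathcal X^\star=\{x\in\mathcal C:x\preccurlyeq y\ \forall y\in\mathcal C\}$. $\preccurlyeq$ is plateau-free if $\partial\mathcal S_x=\mathcal L_x$ for all $x\in\mathcal X\setminus\mathcal X^\star$. It is $r$-regular at $x\in\partial\mathcal S_x$ ($r>0$)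 if there is $n\in\mathbb S^{d-1}$ with $B(x-rn,r)\subseteq\mathcal S_x$ and $B(x+rn,r)\subseteq\overline{\mathcal X\setminus\mathcal S_x}$; this unique $n=:n_x$ is the normal direction at $x$. For $\preccurlyeq_c$ the normal direction at every $x$ is $c$. The normal-direction error of an output $\widehat n$ at a query point $x$ is $\|\widehat n-n_x\|$. *)

(* Defs.v *)
From HB Require Import structures.
From mathcomp Require Import all_boot all_order all_algebra.
From mathcomp Require Import all_classical all_reals all_analysis.

Set Implicit Arguments.
Unset Strict Implicit.
Unset Printing Implicit Defensive.

Import Order.TTheory GRing.Theory Num.Theory.
Import numFieldNormedType.Exports.

Local Open Scope classical_set_scope.
Local Open Scope ring_scope.

HB.instance Definition _ (R : realType) (m n : nat) :=
  @isMeasurable.Build (sigma_display (@open 'M[R]_(m, n)))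
    'M[R]_(m, n) <<s @open 'M[R]_(m, n) >>
    (@sigma_algebra0 _ setT _) (@sigma_algebraC _ _)
    (@sigma_algebra_bigcup _ setT _).

(* Oracle responses -1, 0, 1 are taken in int. *)
HB.instance Definition _ := isPointed.Build int 0.
HB.instance Definition _ := @isMeasurable.Build default_measure_display
  int discrete_measurable discrete_measurable0
  discrete_measurableC discrete_measurableU.

Section Euclidean.
Variables (R : realType) (d : nat).
Local Notation X := 'rV[R]_d.

(* The library norm on 'rV[R]_d is the sup norm, so the Euclidean norm is
   defined here; both induce the topology used for closure and interior. *)
Definition dotp (u v : X) : R := \sum_(i < d) u 0 i * v 0 i.
Definition enorm (u : X) : R := Num.sqrt (dotp u u).
Definition sphere : set X := [set u | enorm u = 1].
Definition cball (z : X) (r : R) : set X := [set y | enorm (y - z) <= r].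
Definition boundary (A : set X) : set X := closure A `\` interior A.

End Euclidean.

Section Preferences.
Variables (R : realType) (d : nat).
Local Notation X := 'rV[R]_d.
Implicit Types (le : rel X) (C : set X) (x y n : X) (r : R).

Definition preference le : Prop := total le /\ transitive le.

Definition indiff le : rel X := fun x y => le x y && le y x.
Definition strict le : rel X := fun x y => le x y && ~~ le y x.

Definition realizes (f : X -> R) le : Prop :=
  forall x y, le x y = (f x <= f y).

Definition lin_pref (c : X) : rel X := fun x y => dotp c x <= dotp c y.

Lemma lin_pref_realized (c : X) : realizes (dotp c) (lin_pref c).
Proof. by []. Qed.

Lemma lin_pref_preference (c : X) : preference (lin_pref c).
Proof.
by split=> [x y|y x z]; [exact: le_total | exact: le_trans].
Qed.

(* For a complete relation the last case is strict le p q. *)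
Definition oracle le (p q : X) : int :=
  if strict le q p then -1 else if indiff le q p then 0 else 1.

Definition sublevel le x : set X := [set y | le y x].
Definition level le x : set X := [set y | indiff le y x].
Definition optimal C le : set X :=
  [set x | C x /\ forall y, C y -> le x y].

Definition plateau_free C le : Prop :=
  forall x, ~ optimal C le x -> boundary (sublevel le x) = level le x.

Definition is_normal le r x n : Prop :=
  [/\ boundary (sublevel le x) x,
      sphere n,
      cball (x - r *: n) r `<=` sublevel le x &
      cball (x + r *: n) r `<=` closure (~` sublevel le x)].

Definition regular_at le r x : Prop := exists n, is_normal le r x n.

(* Minimizers are exempt, as in plateau_free: their sublevel set may have
   empty interior. *)
Definition regular C le r : Prop :=
  forall x, ~ optimal C le x -> regular_at le r x.

End Preferences.

Section Algorithms.
Variables (R : realType) (d : nat).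
Local Notation X := 'rV[R]_d.

Local Notation round := (X * X * int)%type.

(* @query i chooses the pair compared after i rounds; only i < t is used. *)
Record algorithm (t : nat) (disp : measure_display)
    (Xi : measurableType disp) : Type := Algorithm {
  seed_law : probability Xi R ;
  query : forall i : nat, i.-tuple round * Xi -> X * X ;
  output : t.-tuple round * Xi -> X ;
  query_measurable : forall i, (i < t)%N ->
    measurable_fun [set: i.-tuple round * Xi] (@query i) ;
  output_measurable : measurable_fun [set: t.-tuple round * Xi] output }.

Variables (t : nat) (disp : measure_display) (Xi : measurableType disp).
Variables (A : algorithm t Xi) (le : rel X) (xi : Xi).

Fixpoint history (k : nat) : k.-tuple round :=
  match k with
  | 0 => [tuple]
  | k'.+1 =>
      let h := history k' in
      let pq := query A (h, xi) in
      rcons_tuple h (pq.1, pq.2, oracle le pq.1 pq.2)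
  end.

Definition run : X := output A (history t, xi).

End Algorithms.

(* Main.v *)
(* Fix the seed.  Once the direction [c] avoids the finitely many hyperplanes
   on which a queried pair of distinct points is tied, each comparison has at
   most two outcomes, so at most [2 ^ t] outputs occur.  Such [c] are dense in
   the sphere, hence [N = 2 ^ t] balls of radius slightly above [eps] cover the
   sphere, and [N] balls of radius [2 * eps] cover an annulus around it.
   Comparing volumes gives [1 <= N * (2 * eps) ^ (d - 1)], and [2 <= pi].
   The volume comparison is carried out without a measure: covering the annulus
   at all scales recursively covers a large ball by unit balls, and if [N] were
   too small this would use fewer balls than there are points of a separated
   grid in the large ball. *)
Require Import Defs.
From HB Require Import structures.
From mathcomp Require Import all_boot all_order all_algebra.
From mathcomp Require Import all_classical all_reals all_analysis.
From mathcomp Require Import ring lra.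

Set Implicit Arguments.
Unset Strict Implicit.
Unset Printing Implicit Defensive.

Import Order.TTheory GRing.Theory Num.Theory.
Import numFieldNormedType.Exports.

Local Open Scope classical_set_scope.
Local Open Scope ring_scope.

(** * Euclidean inner product and norm on row vectors *)

Section EuclideanNorm.
Variables (R : realType) (d : nat).
Implicit Types (u v w : 'rV[R]_d) (a : R).

Lemma dotpC u v : dotp u v = dotp v u.
Proof. by apply: eq_bigr => i _; rewrite mulrC. Qed.

Lemma dotpDl u v w : dotp (u + v) w = dotp u w + dotp v w.
Proof. by rewrite -big_split; apply: eq_bigr => i _; rewrite mxE mulrDl. Qed.

Lemma dotpZl a u v : dotp (a *: u) v = a * dotp u v.
Proof. by rewrite /dotp mulr_sumr; apply: eq_bigr => i _; rewrite mxE mulrA. Qed.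

Lemma dotpDr u v w : dotp w (u + v) = dotp w u + dotp w v.
Proof. by rewrite dotpC dotpDl !(dotpC w). Qed.

Lemma dotpZr a u v : dotp v (a *: u) = a * dotp v u.
Proof. by rewrite dotpC dotpZl dotpC. Qed.

Lemma dotpNr u v : dotp u (- v) = - dotp u v.
Proof. by rewrite -scaleN1r dotpZr mulN1r. Qed.

Lemma dotpBr u v w : dotp w (u - v) = dotp w u - dotp w v.
Proof. by rewrite dotpDr dotpNr. Qed.

Lemma dotp_ge0 u : 0 <= dotp u u.
Proof. by apply: sumr_ge0 => i _; rewrite -expr2 sqr_ge0. Qed.

Lemma enorm_ge0 u : 0 <= enorm u.
Proof. exact: sqrtr_ge0. Qed.

Lemma enorm_sqr u : enorm u ^+ 2 = dotp u u.
Proof. by rewrite sqr_sqrtr ?dotp_ge0. Qed.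

Lemma dotp_eq0 u : (dotp u u == 0) = (u == 0).
Proof.
apply/idP/eqP => [|->]; last by rewrite -(scale0r 0) dotpZl mul0r.
rewrite psumr_eq0 => [/allP u0|i _]; last by rewrite -expr2 sqr_ge0.
apply/rowP => i; rewrite mxE; apply/eqP.
by have := u0 i (mem_index_enum _); rewrite /= mulf_eq0 orbb.
Qed.

Lemma enorm_eq0 u : (enorm u == 0) = (u == 0).
Proof. by rewrite -dotp_eq0 -enorm_sqr expf_eq0. Qed.

Lemma enorm0 : enorm (0 : 'rV[R]_d) = 0.
Proof. by apply/eqP; rewrite enorm_eq0. Qed.

Lemma enormZ a u : enorm (a *: u) = `|a| * enorm u.
Proof.
by rewrite /enorm dotpZl dotpZr mulrA -expr2 sqrtrM ?sqr_ge0// sqrtr_sqr.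
Qed.

Lemma enormN u : enorm (- u) = enorm u.
Proof. by rewrite -scaleN1r enormZ normrN normr1 mul1r. Qed.

Lemma dotp_le_enorm u v : dotp u v <= enorm u * enorm v.
Proof.
have [->|v0] := eqVneq v 0.
  by rewrite -(scale0r 0) dotpZr mul0r scale0r enorm0 mulr0.
have v_gt0 : 0 < enorm v by rewrite lt_def enorm_eq0 v0 enorm_ge0.
apply: le_trans (ler_norm _) _.
rewrite -ler_sqr ?nnegrE ?mulr_ge0 ?enorm_ge0//.
rewrite real_normK ?num_real// exprMn !enorm_sqr.
(* This square expands to [dotp v v] times the Gram determinant of [u] and [v]; dividing by
   [dotp v v > 0] gives Cauchy-Schwarz. *)
have := dotp_ge0 (dotp v v *: u - dotp u v *: v).
rewrite -scaleNr dotpDl !dotpDr !dotpZl !dotpZr (dotpC v u).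
have : 0 < dotp v v by rewrite -enorm_sqr exprn_gt0.
move: (dotp u u) (dotp v v) (dotp u v) => x y z y0 h.
have : 0 <= y * (x * y - z ^+ 2).
  by apply: le_trans h _; rewrite le_eqVlt; apply/orP; left; apply/eqP; ring.
by rewrite pmulr_rge0// subr_ge0.
Qed.

Lemma enormD u v : enorm (u + v) <= enorm u + enorm v.
Proof.
rewrite -ler_sqr ?nnegrE ?addr_ge0 ?enorm_ge0// sqrrD !enorm_sqr.
rewrite dotpDl !dotpDr (dotpC v u); have := dotp_le_enorm u v.
lra.
Qed.

Lemma enorm_distC u v : enorm (u - v) = enorm (v - u).
Proof. by rewrite -enormN opprB. Qed.

Lemma enorm_dist_le w u v : enorm (u - v) <= enorm (u - w) + enorm (w - v).
Proof. by apply: le_trans (enormD _ _); rewrite addrA subrK. Qed.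

Lemma coord_le_enorm u i : `|u 0 i| <= enorm u.
Proof.
rewrite -ler_sqr ?nnegrE ?enorm_ge0// real_normK ?num_real// enorm_sqr.
rewrite /dotp (bigD1 i)//= -expr2 lerDl.
by apply: sumr_ge0 => j _; rewrite -expr2 sqr_ge0.
Qed.

Lemma enorm_le_coord u a : 0 <= a -> (forall i, `|u 0 i| <= a) ->
  enorm u <= d%:R * a.
Proof.
move=> a0 ua; rewrite -ler_sqr ?nnegrE ?enorm_ge0 ?mulr_ge0// enorm_sqr.
apply: (@le_trans _ _ (\sum_(i < d) a ^+ 2)).
  apply: ler_sum => i _; rewrite -expr2 -real_normK ?num_real//.
  by rewrite ler_sqr ?nnegrE.
rewrite sumr_const card_ord -[X in X <= _]mulr_natl exprMn.
rewrite ler_wpM2r ?sqr_ge0// expr2 -natrM ler_nat.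
by case: (d) => // n; rewrite leq_pmulr.
Qed.

End EuclideanNorm.

(** * Covering numbers by recursion over scales *)

Section Covering.
Variables (R : realType) (d : nat).
Local Notation X := 'rV[R]_d.

Definition unit_ball_cover (s : R) (ys : seq X) :=
  forall x, enorm x <= s -> exists2 y, y \in ys & enorm (x - y) <= 1.

(** The points of [{0, 3, ..., 3(n-1)}^d] lie in the ball of radius [s] and are at mutual distance
    at least 3, so no unit ball contains two of them: choosing a nearby centre for each is
    injective. *)
Lemma grid_le_size_cover (n : nat) (s : R) (ys : seq X) :
  3 * n%:R * d%:R <= s -> unit_ball_cover s ys -> (n ^ d <= size ys)%N.
Proof.
move=> sn cov.
pose g (f : {ffun 'I_d -> 'I_n}) : X := \row_i (3 * (f i)%:R).
have gs f : enorm (g f) <= s.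
  apply: le_trans sn; rewrite mulrC; apply: enorm_le_coord => [|i].
    by rewrite mulr_ge0.
  by rewrite mxE ger0_norm ?mulr_ge0// ler_wpM2l// ler_nat ltnW.
have gcov f : exists k : 'I_(size ys), enorm (g f - nth 0 ys k) <= 1.
  have [y yys ?] := cov _ (gs f).
  have k_lt : (index y ys < size ys)%N by rewrite index_mem.
  by exists (Ordinal k_lt); rewrite /= nth_index.
have [k kP] := choice gcov.
have k_inj : injective k.
  move=> f1 f2 k12; apply/ffunP => i.
  have : enorm (g f1 - g f2) <= 2.
    apply: le_trans (enorm_dist_le (nth 0 ys (k f1)) _ _) _.
    rewrite [X in _ + X]enorm_distC [X in _ + enorm (_ - nth _ _ (nat_of_ord X))]k12.
    by have := kP f1; have := kP f2; lra.
  move=> /(le_trans (coord_le_enorm _ i)); rewrite !mxE -mulrBr normrM normr_nat.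
  move=> le2; apply/val_inj/eqP => /=; rewrite -(eqr_nat R).
  apply: contraTT le2 => f12; rewrite -ltNge.
  suff : (1 : R) <= `|(f1 i)%:R - (f2 i)%:R| by lra.
  by apply: norm_intr_ge1; rewrite ?subr_eq0// rpredB ?natr_int.
by have := leq_card _ k_inj; rewrite card_ffun !card_ord.
Qed.

(** Radial projection to the sphere moves [x] by [|enorm x - 1|], which is at most [h]. *)
Lemma sphere_cover_shell (ys : seq X) (rho h : R) :
  (forall c, sphere c -> exists2 y, y \in ys & enorm (c - y) <= rho) ->
  forall x, x != 0 -> 1 - h <= enorm x <= 1 + h ->
  exists2 y, y \in ys & enorm (x - y) <= rho + h.
Proof.
move=> cov x x0 xh.
have nx : 0 < enorm x by rewrite lt_def enorm_eq0 x0 enorm_ge0.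
have [|y yys le_y] := cov ((enorm x)^-1 *: x).
  by rewrite /sphere /= enormZ gtr0_norm ?invr_gt0// mulVf ?gt_eqF.
exists y => //.
apply: le_trans (enorm_dist_le ((enorm x)^-1 *: x) _ _) _.
rewrite addrC lerD// -[X in enorm (X - _)]scale1r -scalerBl enormZ.
rewrite -[X in _ * X]gtr0_norm// -normrM mulrBl mul1r mulVf ?gt_eqF//.
by rewrite ler_norml; lra.
Qed.

Section Recursion.
Variables (a b : R) (zs : seq X).
Hypotheses (b_gt0 : 0 < b) (le_ba : b <= a) (a_lt1 : a < 1).
Hypothesis zsP : forall x, a <= enorm x <= 1 ->
  exists2 z, z \in zs & enorm (x - z) <= b.

(** The ball of radius [s] is the ball of radius [a * s] together with a scaled annulus. The latter
    is covered by balls of radius [b * s] around the points [s *: z], and each of these by a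
    translate of [ys2]. *)
Lemma cover_recursion (s : R) (ys1 ys2 : seq X) : 0 < s ->
  unit_ball_cover (a * s) ys1 -> unit_ball_cover (b * s) ys2 ->
  exists2 ys, unit_ball_cover s ys &
    size ys = (size ys1 + size zs * size ys2)%N.
Proof.
move=> s0 cov1 cov2.
exists (ys1 ++ [seq s *: z + y | z <- zs, y <- ys2]); last first.
  by rewrite size_cat size_allpairs.
move=> x xs; have [xa|xa] := leP (enorm x) (a * s).
  by have [y yys ?] := cov1 _ xa; exists y; rewrite // mem_cat yys.
have [|z zzs zP] := zsP (x := s^-1 *: x).
  rewrite enormZ gtr0_norm ?invr_gt0// ler_pdivlMl// ler_pdivrMl// mulr1 xs andbT.
  by rewrite mulrC ltW.
have [|y yys yP] := cov2 (x - s *: z).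
  rewrite -[x](scalerKV (a := s)) ?gt_eqF// -scalerBr enormZ gtr0_norm//.
  by rewrite mulrC ler_pM2r.
exists (s *: z + y); last by rewrite opprD addrA.
by rewrite mem_cat; apply/orP; right; apply/allpairsP; exists (z, y).
Qed.

(** Total volume of the pieces relative to the unit ball; the recursion multiplies the constant in
    front of [s ^+ d] by [q]. *)
Let q := a ^+ d + (size zs)%:R * b ^+ d.
Hypothesis q_le1 : q <= 1.

Lemma cover_size_step (C s : R) : 0 < s ->
  (exists2 ys, unit_ball_cover (a * s) ys & (size ys)%:R <= C * (a * s) ^+ d) ->
  (exists2 ys, unit_ball_cover (b * s) ys & (size ys)%:R <= C * (b * s) ^+ d) ->
  exists2 ys, unit_ball_cover s ys & (size ys)%:R <= C * q * s ^+ d.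
Proof.
move=> s0 [ys1 cov1 le1] [ys2 cov2 le2].
have [ys cov size_ys] := cover_recursion s0 cov1 cov2.
exists ys => //; rewrite size_ys natrD natrM.
apply: (le_trans (lerD le1 (ler_wpM2l _ le2))) => //.
by rewrite !exprMn /q le_eqVlt; apply/orP; left; apply/eqP; ring.
Qed.

(** For [q <= 1] the constant [b^-1 ^+ d] survives every recursion step. The recursion stops at
    radii in [[b, 1]], where one ball suffices and the bound is at least 1. *)
Lemma cover_size_scale (s : R) : b <= s ->
  exists2 ys, unit_ball_cover s ys & (size ys)%:R <= b^-1 ^+ d * s ^+ d.
Proof.
have a0 : 0 < a by exact: lt_le_trans b_gt0 le_ba.
move=> bs; have s0 : 0 < s by exact: lt_le_trans bs.
(* The induction is on the number of contractions by [a] that bring [s] below 1; as [b <= a], one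
   step lowers it for both smaller radii. *)
have [j] : exists j, a ^+ j * s <= 1.
  have : a ^+ n @[n --> \oo] --> (0 : R) by apply: cvg_expr; rewrite gtr0_norm.
  move=> /cvgrPdist_le/(_ s^-1).
  rewrite invr_gt0 => /(_ s0) [j _ /(_ j (leqnn _))] /=.
  rewrite sub0r normrN ger0_norm ?exprn_ge0 ?(ltW a0)// => ?.
  by exists j; rewrite -ler_pdivlMr// mul1r.
elim: j s bs s0 => [|j IH] s bs s0 js.
  exists [:: 0] => [x xs|].
    by exists 0; rewrite ?inE// subr0 (le_trans xs)// -[s]mul1r.
  by rewrite -exprMn exprn_ege1// ler_pdivlMl// mulr1.
(* Recursion is used only for [1 < s], which keeps [a * s] and [b * s] at least [b]. *)
have [s1|s1] := leP s 1.
  exists [:: 0] => [x xs|].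
    by exists 0; rewrite ?inE// subr0 (le_trans xs).
  by rewrite -exprMn exprn_ege1// ler_pdivlMl// mulr1.
have [|||ys cov le_ys] := @cover_size_step (b^-1 ^+ d) s.
- by [].
- apply: IH; rewrite ?mulr_gt0//; last by rewrite mulrA -exprSr.
  by rewrite (le_trans le_ba)// ler_peMr 1?ltW.
- apply: IH; rewrite ?mulr_gt0//; first by rewrite ler_peMr 1?ltW.
  apply: le_trans js; rewrite exprSr -mulrA ler_pM2l ?exprn_gt0//.
  by rewrite ler_pM2r.
exists ys => //; apply: le_trans le_ys _.
rewrite ler_pM2r ?exprn_gt0// ler_piMr// exprn_ge0// invr_ge0 ltW//.
Qed.

(** Each of the first [k] steps gains a factor [q]; the hypothesis ensures that after [k]
    contractions the radius is still in the range of [cover_size_scale]. *)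
Lemma cover_size_decay (k : nat) (s : R) : b <= b ^+ k * s ->
  exists2 ys, unit_ball_cover s ys & (size ys)%:R <= b^-1 ^+ d * q ^+ k * s ^+ d.
Proof.
have a0 : 0 < a by exact: lt_le_trans b_gt0 le_ba.
elim: k s => [|k IH] s bs.
  by rewrite mulr1; apply: cover_size_scale; rewrite -[s]mul1r.
have s0 : 0 < s.
  by have := lt_le_trans b_gt0 bs; rewrite pmulr_rgt0// exprn_gt0.
rewrite exprSr [b^-1 ^+ d * _]mulrA; apply: cover_size_step => //; apply: IH.
  apply: le_trans bs _; rewrite exprSr -mulrA ler_pM2l ?exprn_gt0//.
  by rewrite ler_pM2r.
by rewrite mulrA -exprSr.
Qed.

End Recursion.

(** If the sum were below 1, iterating the cover would beat the grid bound: a ball of radius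
    [3 * n * d] would need fewer than [n ^ d] unit balls. *)
Lemma cover_annulus_ge1 (a b : R) (zs : seq X) :
  (0 < d)%N -> 0 < b -> b <= a -> a < 1 ->
  (forall x, a <= enorm x <= 1 ->
    exists2 z, z \in zs & enorm (x - z) <= b) ->
  1 <= a ^+ d + (size zs)%:R * b ^+ d.
Proof.
move=> d0 b0 ba a1 zsP; rewrite leNgt; apply/negP => q1.
set q := (X in X < 1) in q1.
have a0 : 0 < a by exact: lt_le_trans b0 ba.
have q0 : 0 < q by rewrite ltr_pwDl ?exprn_gt0// mulr_ge0// exprn_ge0// ltW.
(* At radius [3 * n * d] the cover size is at most [q ^+ k * M * n ^ d]. Since [M] is independent of
   [n], [k] can be fixed first and [n] then taken large enough to allow [k] steps. *)
pose M := b^-1 ^+ d * (3 * d%:R) ^+ d.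
have M0 : 0 < M by rewrite mulr_gt0// exprn_gt0 ?invr_gt0// mulr_gt0// ltr0n.
have [k kP] : exists k, q ^+ k * M < 1.
  have : q ^+ n @[n --> \oo] --> (0 : R) by apply: cvg_expr; rewrite gtr0_norm.
  move=> /cvgrPdist_lt/(_ M^-1).
  rewrite invr_gt0 => /(_ M0) [k _ /(_ k (leqnn _))] /=.
  rewrite sub0r normrN ger0_norm ?exprn_ge0 ?(ltW q0)// => ?.
  by exists k; rewrite -ltr_pdivlMr// mul1r.
pose n := (Num.bound (b / b ^+ k)).+1.
have n0 : (0 : R) < n%:R by rewrite ltr0n.
have [|ys cov le_ys] :=
    @cover_size_decay a b zs b0 ba a1 zsP (ltW q1) k (3 * n%:R * d%:R).
  rewrite mulrC -ler_pdivrMr ?exprn_gt0//.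
  have le_n : b / b ^+ k <= n%:R.
    by apply: le_trans (ltW (unstable.ltr_bound _)) _; rewrite ler_nat.
  have : (1 : R) <= d%:R by rewrite ler1n.
  nra.
have := grid_le_size_cover (lexx _) cov.
rewrite -(ler_nat R) natrX => /le_trans/(_ le_ys).
rewrite [leRHS](_ : _ = q ^+ k * M * n%:R ^+ d); last first.
  by rewrite -/q /M (mulrAC 3) [in LHS]exprMn !mulrA (mulrC (q ^+ k)).
by rewrite leNgt gtr_pMl ?exprn_gt0// kP.
Qed.

(** Enlarging the radius to [rho + h] covers the shell of half-width [h], which rescales by
    [1 / (1 + h)] to an annulus with outer radius 1; [rho + 2 * h <= 1] says that the scaled radii
    satisfy [b <= a]. *)
Lemma sphere_cover_size (rho h : R) (ys : seq X) :
  (0 < d)%N -> 0 < rho -> 0 < h -> rho + 2 * h <= 1 ->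
  (forall c, sphere c -> exists2 y, y \in ys & enorm (c - y) <= rho) ->
  2 * d%:R * h <= (size ys)%:R * (rho + h) ^+ d.
Proof.
move=> d0 rho0 h0 rhoh cov.
have h1 : 0 < 1 + h by lra.
have annulus x : (1 - h) / (1 + h) <= enorm x <= 1 ->
    exists2 z, z \in [seq (1 + h)^-1 *: y | y <- ys] &
      enorm (x - z) <= (rho + h) / (1 + h).
  rewrite ler_pdivrMr// => /andP[xa x1].
  have x0 : 0 < enorm x.
    by rewrite -(pmulr_lgt0 _ h1); apply: lt_le_trans xa; lra.
  have [||y yys yP] := sphere_cover_shell cov (x := (1 + h) *: x) (h := h).
  - by rewrite scaler_eq0 negb_or gt_eqF//= -enorm_eq0 gt_eqF.
  - rewrite enormZ gtr0_norm// mulrC xa/= mulrC.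
    by rewrite -[X in _ <= X]mulr1 ler_pM2l.
  exists ((1 + h)^-1 *: y); first exact: map_f.
  rewrite -[x](scalerK (a := 1 + h)) ?gt_eqF// -scalerBr enormZ.
  by rewrite gtr0_norm ?invr_gt0// mulrC ler_pM2r ?invr_gt0.
have := cover_annulus_ge1 d0 _ _ _ annulus.
rewrite divr_gt0 ?addr_gt0// ler_pM2r ?invr_gt0// ltr_pdivrMr// size_map.
move=> /(_ isT); rewrite !expr_div_n.
have -> : rho + h <= 1 - h by lra.
have -> : 1 - h < 1 * (1 + h) by lra.
move=> /(_ isT isT); rewrite mulrA -mulrDl ler_pdivlMr ?exprn_gt0// mul1r.
rewrite -lerBlDl; apply: le_trans.
(* It remains to bound [(1 + h) ^ d - (1 - h) ^ d] below by [2 * d * h]. Going from [n] to [n + 1]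
   adds [h * ((1 + h) ^ n + (1 - h) ^ n)], and Bernoulli's inequality makes this at least
   [2 * h]. *)
elim: (d) => [|n IH]; first by rewrite mulr0 mul0r !expr0 subrr.
have le_pow : forall m, (1 - h) ^+ m <= 1 <= (1 + h) ^+ m.
  by move=> m; rewrite exprn_ege1 ?exprn_ile1//; lra.
have bern : 2 <= (1 + h) ^+ n + (1 - h) ^+ n.
  have : 1 + n%:R * h <= (1 + h) ^+ n /\ 1 - n%:R * h <= (1 - h) ^+ n.
    elim: n {IH} => [|n [IH1 IH2]]; first by rewrite !expr0 mul0r addr0 subr0.
    rewrite !exprS -natr1; have := ler0n R n.
    have h_le1 : 0 <= 1 - h by lra.
    split; first nra.
    have := ler_wpM2l h_le1 IH2; nra.
  lra.
rewrite !exprS -natr1.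
set u := (1 + h) ^+ n in IH bern *; set v := (1 - h) ^+ n in IH bern *.
nra.
Qed.

End Covering.

(** * Linear preferences: plateau-freeness, regularity and normals *)

Section HalfSpace.
Variables (R : realType) (d : nat).
Local Notation X := 'rV[R]_d.

Lemma dotp_continuous (c : X) : continuous (dotp c).
Proof.
move=> x; apply: (@cvg_big R _ +%R 0 _ _ X (nbhs x)) => [|i _].
  exact: add_continuous.
by apply: cvgM; [exact: cvg_cst | exact: coord_continuous].
Qed.

Lemma sphere_dotp (c : X) : sphere c -> dotp c c = 1.
Proof. by rewrite -enorm_sqr => ->; rewrite expr1n. Qed.

Lemma nbhs_push (c y : X) (A : set X) : nbhs y A ->
  exists2 e : R, 0 < e & A (y + e *: c).
Proof.
move=> yA.
have : y + e *: c @[e --> (0 : R)] --> y.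
  rewrite -[X in _ --> X]addr0 -(scale0r c).
  by apply: cvgD; [exact: cvg_cst | exact: scalel_continuous].
move=> /(_ _ yA)/nbhs_ballP[e /= e0 eA].
exists (e / 2); first by rewrite divr_gt0.
apply: eA; rewrite /ball /= sub0r normrN gtr0_norm ?divr_gt0//.
by rewrite ltr_pdivrMr// mulr2n; lra.
Qed.

(** The sublevel set is a closed half-space. The strict half-space is open, hence interior, while a
    tied point leaves the sublevel set under any small push along [c]. *)
Lemma boundary_lin_pref (c x : X) : sphere c ->
  boundary (sublevel (lin_pref c) x) = level (lin_pref c) x.
Proof.
move=> c1.
have SE : sublevel (lin_pref c) x = dotp c @^-1` [set s | s <= dotp c x] by [].
have S_closed : closed (sublevel (lin_pref c) x).
  rewrite SE; apply: closed_comp; last exact: closed_le.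
  by move=> y _; exact: dotp_continuous.
rewrite /boundary -(proj1 (closure_id _) S_closed).
apply/seteqP; split => y; rewrite /level /sublevel /indiff /lin_pref /=.
- move=> [yx yi]; rewrite yx /= leNgt; apply/negP => xy; apply: yi.
  have lt_open : open (dotp c @^-1` [set s | s < dotp c x]).
    by apply: open_comp; [move=> ? _; exact: dotp_continuous | exact: open_lt].
  suff : dotp c @^-1` [set s | s < dotp c x] `<=` (sublevel (lin_pref c) x)°.
    exact.
  by rewrite -open_subsetE// => z /= /ltW.
- move=> /andP[yx xy]; split => // /(nbhs_push c)[e e0] /=.
  rewrite dotpDr dotpZr sphere_dotp// mulr1 => yex.
  by have := le_trans yex xy; rewrite gerDl leNgt e0.
Qed.

(** By Cauchy-Schwarz with the unit vector [c], the two balls lie on opposite sides of the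
    hyperplane through [x]; a push along [c] puts the upper closed half-space in the closure of the
    complement. *)
Lemma is_normal_lin_pref (c x : X) (r : R) : sphere c -> 0 < r ->
  is_normal (lin_pref c) r x c.
Proof.
move=> c1 r0; split => //.
- by rewrite boundary_lin_pref// /level /indiff /lin_pref /= lexx.
- move=> y yr; rewrite /sublevel /lin_pref /=.
  have := dotp_le_enorm c (y - (x - r *: c)).
  rewrite (c1 : enorm c = 1) mul1r => /le_trans/(_ yr).
  by rewrite !dotpBr dotpZr sphere_dotp//; lra.
- move=> y yr.
  have xy : dotp c x <= dotp c y.
    have := dotp_le_enorm c ((x + r *: c) - y).
    rewrite (c1 : enorm c = 1) mul1r enorm_distC => /le_trans/(_ yr).
    by rewrite dotpBr dotpDr dotpZr sphere_dotp//; lra.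
  move=> A /(nbhs_push c)[e e0 Ay]; exists (y + e *: c); split => //.
  rewrite /sublevel /lin_pref /= dotpDr dotpZr sphere_dotp// mulr1.
  by apply/negP; rewrite -ltNge (le_lt_trans xy)// ltrDl.
Qed.

Lemma plateau_free_lin_pref (C : set X) (c : X) :
  sphere c -> plateau_free C (lin_pref c).
Proof. by move=> c1 x _; exact: boundary_lin_pref. Qed.

Lemma regular_lin_pref (C : set X) (c : X) (r : R) :
  sphere c -> 0 < r -> regular C (lin_pref c) r.
Proof. by move=> c1 r0 x _; exists c; exact: is_normal_lin_pref. Qed.

End HalfSpace.

(** * Density of directions off finitely many hyperplanes *)

Section Genericity.
Variables (R : realType) (d : nat).
Local Notation X := 'rV[R]_d.

(** A nonzero polynomial has fewer than [size p] roots, so one of the [size p] distinct values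
    [e / i.+1] is not a root. *)
Lemma poly_nonroot_small (p : {poly R}) (e : R) : p != 0 -> 0 < e ->
  exists2 tau, 0 < tau <= e & ~~ root p tau.
Proof.
move=> p0 e0; apply: contrapT => nex.
pose rs := [seq e / i.+1%:R | i <- iota 0 (size p)].
have : (size rs < size p)%N.
  apply: max_poly_roots p0 _ _.
  - apply/allP => _ /mapP[i _ ->]; apply: contrapT => /negP nr; apply: nex.
    exists (e / i.+1%:R) => //.
    by rewrite divr_gt0//= ler_pdivrMr// ler_peMr ?ler1n// ltW.
  - rewrite map_inj_uniq ?iota_uniq// => i j /(mulfI (lt0r_neq0 e0)).
    by move=> /invr_inj/eqP; rewrite eqr_nat => /eqP[].
by rewrite size_map size_iota ltnn.
Qed.

(* The perturbation moves along the moment curve, on which no nonzero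
   linear form vanishes identically. *)
Lemma generic_perturbation (F : seq X) (c : X) (e : R) :
  0 < e -> {in F, forall v, v != 0} ->
  exists2 c', enorm (c' - c) <= e & {in F, forall v, dotp c' v != 0}.
Proof.
move=> e0 F0.
(* At [tau], [P v] is the inner product of [v] with [c + (tau, ..., tau ^ d)]. The factor ['X] keeps
   the coordinates of [v] apart from the constant term, so [P v] is nonzero when [v] is. *)
pose P (v : X) : {poly R} :=
  (dotp c v)%:P + 'X * \sum_(i < d) (v 0 i) *: 'X^i.
have P0 v : v != 0 -> P v != 0.
  apply: contraNneq => Pv0; apply/eqP/rowP => i.
  have := congr1 (fun p : {poly R} => p`_i.+1) Pv0.
  rewrite coefD coefC coefXM /= add0r coef0 coef_sum (bigD1 i)//= big1.
    by rewrite addr0 coefZ coefXn eqxx mulr1 mxE.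
  by move=> j ji; rewrite coefZ coefXn eq_sym (negPf (_ : (j : nat) != i)) ?mulr0.
(* The bound 1 gives [tau ^+ i.+1 <= tau]; the other makes [d * tau] at most [e], with [d.+1] to
   include [d = 0]. *)
pose delta := Num.min 1 (e / d.+1%:R).
have delta0 : 0 < delta by rewrite lt_min ltr01 divr_gt0.
have [tau /andP[tau0 tau_le] nroot] :
    exists2 tau, 0 < tau <= delta & ~~ root (\prod_(v <- F) P v) tau.
  apply: poly_nonroot_small => //; rewrite prodf_seq_neq0.
  by apply/allP => v vF; apply/implyP => _; apply: P0; exact: F0.
have [tau1 taue] : tau <= 1 /\ tau <= e / d.+1%:R.
  by move: tau_le; rewrite le_min => /andP[].
exists (c + \row_i tau ^+ i.+1).
  rewrite addrC addKr; apply: le_trans (enorm_le_coord (ltW tau0) _) _.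
    move=> i; rewrite mxE ger0_norm ?exprn_ge0 ?(ltW tau0)//.
    by rewrite exprS ler_piMr ?(ltW tau0)// exprn_ile1// ltW.
  apply: le_trans (ler_wpM2l _ taue) _ => //.
  by rewrite mulrA ler_pdivrMr// mulrC ler_wpM2l ?(ltW e0)// ler_nat.
move=> v vF; apply: contra nroot => /eqP c'v.
rewrite rootE horner_prod prodf_seq_eq0; apply/hasP; exists v => //=.
rewrite /P hornerD hornerC hornerM hornerX horner_sum.
apply/eqP; rewrite -[RHS]c'v dotpDl; congr (_ + _).
rewrite mulr_sumr; apply: eq_bigr => i _.
by rewrite hornerZ hornerXn mxE exprS; ring.
Qed.

Lemma generic_sphere_approx (F : seq X) (c : X) (e : R) :
  0 < e -> sphere c -> {in F, forall v, v != 0} ->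
  exists2 c', sphere c' /\ enorm (c' - c) <= e &
    {in F, forall v, dotp c' v != 0}.
Proof.
move=> e0 c1 F0.
(* Half of [e] is spent on the perturbation and half on normalising; [1 / 2] keeps the perturbed
   vector nonzero. *)
pose e' := Num.min (1 / 2) (e / 2).
have e'0 : 0 < e' by rewrite lt_min !divr_gt0.
have [e'1 e'e] : e' <= 1 / 2 /\ e' <= e / 2.
  by split; rewrite ge_min lexx ?orbT.
have [w wc Fw] := generic_perturbation c e'0 F0.
have w_ge : 1 - e' <= enorm w.
  have := enorm_dist_le w c 0; rewrite !subr0 (c1 : enorm c = 1) enorm_distC.
  by move: wc; lra.
have w_le : enorm w <= 1 + e'.
  have := enorm_dist_le c w 0; rewrite !subr0 (c1 : enorm c = 1).
  by move: wc; lra.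
have w0 : 0 < enorm w by lra.
exists ((enorm w)^-1 *: w).
  split.
    by rewrite /sphere /= enormZ gtr0_norm ?invr_gt0// mulVf ?gt_eqF.
  apply: le_trans (enorm_dist_le w _ _) _.
  rewrite -[X in enorm (_ - X) + _]scale1r -scalerBl enormZ.
  rewrite -[X in _ * X]gtr0_norm// -normrM mulrBl mul1r mulVf ?gt_eqF//.
  have : `|1 - enorm w| <= e' by rewrite ler_norml; lra.
  lra.
by move=> v vF; rewrite dotpZl mulf_eq0 negb_or invr_eq0 gt_eqF//= Fw.
Qed.

End Genericity.

(** * Counting transcripts at a fixed seed *)

Section Transcripts.
Variables (R : realType) (d t : nat) (disp : measure_display).
Variables (Xi : measurableType disp) (A : algorithm R d t Xi) (xi : Xi).
Local Notation X := 'rV[R]_d.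
Local Notation round := (X * X * int)%type.

(** The Boolean encodes the two untied responses, [true] standing for -1; a query of equal points is
    always answered 0. *)
Definition answer (k : nat) (s : bool) (h : k.-tuple round) :
    k.+1.-tuple round :=
  let pq := query A (h, xi) in
  rcons_tuple h (pq.1, pq.2, if pq.1 == pq.2 then 0 else (-1) ^+ s).

(** [H] is the binary tree of possible transcripts and [F] collects the nonzero differences of the
    pairs queried along it. Both are chosen before [c]; if [c] is orthogonal to no element of [F],
    each round follows one of two branches. *)
Lemma generic_history (k : nat) :
  exists (H : seq (k.-tuple round)) (F : seq X),
    [/\ size H = (2 ^ k)%N, {in F, forall v, v != 0} &
      forall c, {in F, forall v, dotp c v != 0} ->
        history A (lin_pref c) xi k \in H].
Proof.
elim: k => [|k [H [F [sizeH F0 HP]]]].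
  by exists [:: [tuple]], [::]; split=> // c _; rewrite inE.
pose diff (h : k.-tuple round) := (query A (h, xi)).2 - (query A (h, xi)).1.
exists ([seq answer false h | h <- H] ++ [seq answer true h | h <- H]).
exists (F ++ [seq v <- [seq diff h | h <- H] | v != 0]); split.
- by rewrite size_cat !size_map sizeH addnn expnS mul2n.
- move=> v; rewrite mem_cat mem_filter => /orP[/F0//|/andP[]//].
move=> c Fc; set h := history A (lin_pref c) xi k.
have hH : h \in H by apply: HP => v vF; apply: Fc; rewrite mem_cat vF.
have -> : history A (lin_pref c) xi k.+1 =
    answer (dotp c (diff h) < 0) h.
  apply: val_inj => /=; rewrite -/h; congr (rcons _ (_, _, _)).
  have [pq|pq] := eqVneq (query A (h, xi)).1 (query A (h, xi)).2.
    by rewrite pq /oracle /strict /indiff /lin_pref !lexx.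
  have : dotp c (diff h) != 0.
    apply: Fc; rewrite mem_cat mem_filter subr_eq0 eq_sym pq /=.
    by rewrite map_f ?orbT.
  rewrite /diff dotpBr subr_eq0 subr_lt0 /oracle /strict /indiff /lin_pref.
  by case: ltgtP.
by case: (_ < 0); rewrite mem_cat !(map_f (answer _)) ?orbT.
Qed.

Lemma algorithm_packing_bound (eps : R) : (2 <= d)%N -> 0 < eps -> 4 * eps < 1 ->
  (forall c, sphere c -> enorm (run A (lin_pref c) xi - c) <= eps) ->
  1 <= 2 ^+ t * (2 * eps) ^+ d.-1.
Proof.
move=> d2 eps0 eps4 accurate; have d0 : (0 < d)%N by exact: ltnW.
have [H [F [sizeH F0 HP]]] := generic_history t.
pose ys := [seq output A (h, xi) | h <- H].
have cov c : sphere c -> exists2 y, y \in ys & enorm (c - y) <= 3 / 2 * eps.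
  (* The radius [3 / 2 * eps] is the error [eps] plus [eps / 2] for moving to a generic direction.
     With [h = eps / 2] below, the enlarged radius is [2 * eps]. *)
  move=> c1; have eps2 : 0 < eps / 2 by lra.
  have [c' [c'1 c'c] Fc'] := generic_sphere_approx eps2 c1 F0.
  exists (run A (lin_pref c') xi); first exact/map_f/HP.
  apply: le_trans (enorm_dist_le c' _ _) _.
  rewrite enorm_distC [X in _ + X]enorm_distC.
  by have := accurate _ c'1; lra.
have := sphere_cover_size d0 _ _ _ cov (h := eps / 2).
rewrite size_map sizeH natrX.
have -> : 3 / 2 * eps + eps / 2 = 2 * eps by lra.
have -> : 0 < 3 / 2 * eps by lra.
have -> : 0 < eps / 2 by lra.
have -> : 3 / 2 * eps + 2 * (eps / 2) <= 1 by lra.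
move=> /(_ isT isT isT); rewrite -[in _ ^+ d](prednK d0) exprS.
have : (2 : R) <= d%:R by rewrite ler_nat.
rewrite (mulrCA (2 ^+ t)) => d2R le.
(* The lower bound [2 * d * h] equals [d * eps], at least [2 * eps] as [d >= 2]; this cancels one of
   the [d] factors. *)
have : 2 * eps * 1 <= 2 * eps * (2 ^+ t * (2 * eps) ^+ d.-1).
  by apply: le_trans le; nra.
by rewrite ler_pM2l// mulr_gt0.
Qed.

End Transcripts.

(** * From the covering inequality to logarithmic rates *)

Section Rates.
Variable R : realType.
Implicit Types (d t : nat) (eps : R).

Lemma eps_lt_quarter eps : eps < 1 / (2 * pi) -> 4 * eps < 1.
Proof.
have pi2 := pi_ge2 R; rewrite ltr_pdivlMr ?mulr_gt0 ?pi_gt0//.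
have [e0 h|e0 _] := leP 0 eps; [nra|lra].
Qed.

Lemma rounds_ge d t eps : 0 < eps -> 1 <= 2 ^+ t * (2 * eps) ^+ d.-1 ->
  d.-1%:R * ln (1 / (2 * eps)) <= t%:R * ln 2.
Proof.
move=> eps0 h; have e2 : 0 < 2 * eps by rewrite mulr_gt0.
rewrite div1r lnV ?posrE// mulrN lerNl -subr_ge0 opprK.
rewrite ![_ * ln _]mulr_natl -!lnXn// addrC -lnM ?posrE ?exprn_gt0// ln_ge0//.
Qed.

End Rates.

Theorem corollary3p15 (R : realType) :
  (forall (d : nat) (eps : R), (2 <= d)%N -> 0 < eps -> eps < 1 / (2 * pi) ->
     forall (t : nat) (disp : measure_display) (Xi : measurableType disp)
            (A : algorithm R d t Xi), (1 <= t)%N ->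
     (forall (xi : Xi) (c : 'rV[R]_d), sphere c ->
        sphere (run A (lin_pref c) xi) /\
        enorm (run A (lin_pref c) xi - c) <= eps) ->
     (d%:R - 1) * (ln (1 / (pi * eps)) / ln 2) - 1 < t%:R) /\
  (exists kappa : R, 0 < kappa /\
     forall (d : nat) (eps : R), (2 <= d)%N -> 0 < eps -> eps < 1 / (2 * pi) ->
     forall (C : set 'rV[R]_d) (r : R) (x : 'rV[R]_d), 0 < r ->
     forall (t : nat) (disp : measure_display) (Xi : measurableType disp)
            (A : algorithm R d t Xi), (1 <= t)%N ->
     (forall (xi : Xi) (le : rel 'rV[R]_d) (n : 'rV[R]_d),
        preference le -> plateau_free C le -> regular C le r ->
        is_normal le r x n ->
        enorm (run A le xi - n) <= eps) ->
     kappa * d%:R * ln (1 / eps) <= t%:R).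
Proof.
have ln2 : 0 < ln (2 : R) by rewrite ln_gt0 ?ltr1n.
split.
  move=> d eps d2 eps0 epsP t disp Xi A _ accurate.
  have eps4 := eps_lt_quarter epsP.
  have : d.-1%:R * ln (1 / (2 * eps)) <= t%:R * ln 2.
    apply: rounds_ge => //.
    (* The guarantee holds for every seed, so it is applied at the default seed [point]. *)
    apply: (@algorithm_packing_bound _ _ _ _ _ A point _ d2 eps0 eps4) => c c1.
    by have [] := accurate point c c1.
  have le_ln : ln (1 / (pi * eps)) <= ln (1 / (2 * eps)).
    rewrite ler_ln ?posrE ?divr_gt0 ?mulr_gt0 ?pi_gt0// !div1r.
    by rewrite lef_pV2 ?posrE ?mulr_gt0 ?pi_gt0// ler_pM2r// pi_ge2.
  move=> /(le_trans (ler_wpM2l (ler0n _ _) le_ln)).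
  rewrite -ler_pdivrMr// -mulrA => le_t.
  by rewrite -(natrB _ (ltnW d2)) subn1 ltrBlDr (le_lt_trans le_t)// ltrDl.
(* The 4 comes from [d - 1 >= d / 2] and [ln (1 / eps) - ln 2 >= ln (1 / eps) / 2], the latter
   because [eps < 1 / 4]; [ln 2] converts from base 2. *)
exists (1 / (4 * ln 2)); split; first by rewrite divr_gt0 ?mulr_gt0.
move=> d eps d2 eps0 epsP C r x r0 t disp Xi A _ accurate.
have eps4 := eps_lt_quarter epsP.
have : d.-1%:R * ln (1 / (2 * eps)) <= t%:R * ln 2.
  apply: rounds_ge => //.
  apply: (@algorithm_packing_bound _ _ _ _ _ A point _ d2 eps0 eps4) => c c1.
  (* Linear preferences belong to the class for every [C] and [r], and their normal at [x] is
     [c]. *)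
  apply: accurate.
  - exact: lin_pref_preference.
  - exact: plateau_free_lin_pref.
  - exact: regular_lin_pref.
  - exact: is_normal_lin_pref.
have -> : ln (1 / (2 * eps)) = ln (1 / eps) - ln 2.
  by rewrite !div1r !lnV ?posrE ?mulr_gt0// lnM ?posrE// opprD addrC.
have : 2 * ln 2 <= ln (1 / eps).
  rewrite mulr_natl -lnXn// ler_ln ?posrE ?divr_gt0// ler_pdivlMr//.
  by rewrite -natrX ltW.
have d2R : (2 : R) <= d%:R by rewrite ler_nat.
have -> : d.-1%:R = d%:R - 1 :> R by rewrite -subn1 natrB// ltnW.
rewrite -mulrA [1 / (4 * _)]div1r ler_pdivrMl ?mulr_gt0//.
move: (ln (1 / eps)) (ln 2) (t%:R : R) (d%:R : R) d2R ln2 => L l s D D2 l0 Ll le_t.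
have : D / 2 * (L / 2) <= (D - 1) * (L - l) by apply: ler_pM; lra.
nra.
Qed.
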